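(* Let $G$ be a finite, simple, connected, claw-free graph with minimum degree $\delta(G) \ge 1$. Then $Z(G) \le \beta(G)$. Moreover, this bound is sharp: there exist connected claw-free graphs $G$ with $\delta(G)\ge 1$ for which $Z(G) = \beta(G)$.
   Context: A graph is claw-free if it contains no induced subgraph isomorphic to $K_{1,3}$. A vertex cover of $G$ is a set $C \subseteq V(G)$ such that every edge has at least one endpoint in $C$; $\beta(G)$ is the minimum cardinality of a vertex cover. Zero forcing process: starting from a set $B \subseteq V(G)$ of vertices colored blue (all others white), repeatedly, if a blue vertex has exactly one white neighbor, that neighbor is colored blue. $B$ is a zero forcing set if eventually all vertices become blue. $Z(G)$, the zero forcing number, is the minimum cardinality of a zero forcing set of $G$. *)

(* Defs.v *)
From mathcomp Require Import all_boot.

Set Implicit Arguments.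
Unset Strict Implicit.
Unset Printing Implicit Defensive.

Record sgraph := SGraph {
  vertex :> finType;
  adj : rel vertex;
  adj_sym : symmetric adj;
  adj_irrefl : irreflexive adj
}.

Definition iso_sgraph (G H : sgraph) : Prop :=
  exists2 f : G -> H, bijective f & forall x y, adj (f x) (f y) = adj x y.

Section Induced.
Variables (G : sgraph) (S : {set G}).
Definition induced_adj : rel {x : G | x \in S} :=
  fun x y => adj (val x) (val y).
Lemma induced_sym : symmetric induced_adj.
Proof. by move=> x y; apply: adj_sym. Qed.
Lemma induced_irrefl : irreflexive induced_adj.
Proof. by move=> x; apply: adj_irrefl. Qed.
Definition induced : sgraph := SGraph induced_sym induced_irrefl.
End Induced.

Section CompleteBipartite.
Variables m n : nat.
Definition bip_adj : rel ('I_m + 'I_n)%type :=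
  fun x y => match x, y with
             | inl _, inr _ | inr _, inl _ => true
             | _, _ => false
             end.
Lemma bip_sym : symmetric bip_adj.
Proof. by case=> ? []. Qed.
Lemma bip_irrefl : irreflexive bip_adj.
Proof. by case. Qed.
Definition complete_bipartite : sgraph := SGraph bip_sym bip_irrefl.
End CompleteBipartite.

Definition claw_free (G : sgraph) : Prop :=
  ~ exists S : {set G}, iso_sgraph (induced S) (complete_bipartite 1 3).

(* The empty graph is not connected. *)
Definition connected_graph (G : sgraph) : Prop :=
  0 < #|G| /\ forall x y : G, connect (@adj G) x y.

Section Invariants.
Variable G : sgraph.

Definition neighbors (u : G) : {set G} := [set v | adj u v].
Definition degree (u : G) : nat := #|neighbors u|.

(* Every degree is smaller than #|G|, so on a nonempty graph the default
   value does not affect the minimum; the empty graph gets 0. *)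
Definition min_degree : nat := \big[minn/#|G|]_(u : G) degree u.

Definition vertex_cover (C : {set G}) : bool :=
  [forall u, forall v, adj u v ==> (u \in C) || (v \in C)].

(* The full vertex set is a cover, so the minimum is well defined. *)
Definition cover_number : nat :=
  #|[arg min_(C < [set: G] | vertex_cover C) #|C| ]|.

(* One application of the color change rule, sets being the sets of blue
   vertices: v is the unique white neighbor of the blue vertex u. *)
Definition force_step : rel {set G} :=
  fun B B' => [exists u in B, exists v,
    (neighbors u :\: B == [set v]) && (B' == v |: B)].

Definition zero_forcing_set (B : {set G}) : bool :=
  connect force_step B [set: G].

(* The full vertex set is zero forcing, so the minimum is well defined. *)
Definition zero_forcing_number : nat :=
  #|[arg min_(B < [set: G] | zero_forcing_set B) #|B| ]|.

End Invariants.

(* Main.v *)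
(** Let [C] be a vertex cover and [I] its complement, an independent set. By
    claw-freeness a vertex of [C] has at most two neighbors in [I], so [C] acts
    as the edge set of a multigraph on [I]. In each component of this
    multigraph pick a vertex [v] and a neighbor [c] of [v], and exchange [c]
    for [v] in [C]. This preserves the cardinality, and the result is a zero
    forcing set: the only white neighbor of [v] is [c], since another exchanged
    neighbor would come from the same component; once [C] is blue, the color
    spreads from [v] along the edges of its component. For sharpness take
    [K_2]. *)
Require Import Defs.
From mathcomp Require Import all_boot.

Set Implicit Arguments.
Unset Strict Implicit.
Unset Printing Implicit Defensive.

(** Lets an induced subgraph be exhibited by an embedding of the pattern instead of a vertex set
    with an isomorphism. *)
Lemma iso_induced_imset (G H : sgraph) (g : H -> G) :
  injective g -> (forall x y, adj (g x) (g y) = adj x y) ->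
  iso_sgraph (induced (g @: [set: H])) H.
Proof.
move=> g_inj g_adj.
have gS x : g x \in g @: [set: H] by apply: imset_f.
pose g' x : induced (g @: [set: H]) := exist _ (g x) (gS x).
have g'_bij : bijective g'.
  apply: inj_card_bij => [x y /(congr1 val) /g_inj //|].
  by rewrite card_sig -[#|H|]cardsT; apply: leq_imset_card.
case: (g'_bij) => f g'K fK; exists f => [|x y]; first by exists g'.
by rewrite -[in RHS](fK x) -[in RHS](fK y) /= /induced_adj /= g_adj.
Qed.

(** Otherwise [c] as center and [x], [y], [z] as leaves would span an induced claw. *)
Lemma claw_free_adj (G : sgraph) (c x y z : G) :
  claw_free G -> adj c x -> adj c y -> adj c z -> uniq [:: x; y; z] ->
  [|| adj x y, adj x z | adj y z].
Proof.
move=> clawG cx cy cz Uxyz; apply: contraT; rewrite !negb_or.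
case/and3P=> /negbTE xy /negbTE xz /negbTE yz; case: clawG.
pose t := [tuple x; y; z].
pose g (a : complete_bipartite 1 3) : G := if a is inr i then tnth t i else c.
have adj_ct i : adj c (tnth t i).
  by case: i => -[|[|[|]]].
have adj_tt i j : adj (tnth t i) (tnth t j) = false.
  case: i j => -[|[|[|//]]] ? [[|[|[|//]]] ?];
  by rewrite /tnth /= ?adj_irrefl // adj_sym.
exists (g @: setT); apply: iso_induced_imset => [[i|i] [j|j] /= eq_g|].
- by rewrite !ord1.
- by have := adj_ct j; rewrite -eq_g adj_irrefl.
- by have := adj_ct i; rewrite eq_g adj_irrefl.
- by congr inr; apply: (tuple_uniqP t Uxyz).
- by case=> [i|i] [j|j]; rewrite /= ?adj_irrefl ?adj_tt ?adj_ct // adj_sym adj_ct.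
Qed.

Lemma min_degree_le (G : sgraph) (u : G) : min_degree G <= degree u.
Proof.
rewrite /min_degree; have: u \in index_enum G by rewrite mem_index_enum.
elim: (index_enum G) => // v s IHs; rewrite inE big_cons geq_min.
by case/predU1P=> [<-|/IHs ->]; rewrite ?leqnn ?orbT.
Qed.

Lemma cover_number_le (G : sgraph) (C : {set G}) :
  vertex_cover C -> cover_number G <= #|C|.
Proof.
move=> coverC; rewrite /cover_number; case: arg_minnP => [|D _ -> //].
by apply/forallP=> u; apply/forallP=> v; rewrite !inE implybT.
Qed.

Lemma zero_forcing_number_le (G : sgraph) (B : {set G}) :
  zero_forcing_set B -> zero_forcing_number G <= #|B|.
Proof.
move=> zfB; rewrite /zero_forcing_number; case: arg_minnP => [|D _ -> //].
exact: connect0.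
Qed.

Lemma force_step_sub (G : sgraph) (A B : {set G}) :
  connect (@force_step G) A B -> A \subset B.
Proof.
case/connectP=> p; elim: p A => [|D p IHp] A /=; first by move=> _ ->.
case/andP=> /existsP[u /andP[_ /existsP[v /andP[_ /eqP ->]]]] pathp defB.
exact: subset_trans (subsetUr _ _) (IHp _ pathp defB).
Qed.

(** A largest set reachable from [B] admits no further force, since a force adds a vertex. This
    replaces the construction of a forcing sequence by reasoning about sets closed under forcing. *)
Lemma zero_forcing_stalled (G : sgraph) (B : {set G}) :
  (forall D : {set G}, B \subset D ->
     (forall u v, u \in D -> neighbors u :\: D != [set v]) -> D = [set: G]) ->
  zero_forcing_set B.
Proof.
move=> stalledT.
case: (arg_maxnP (fun D : {set G} => #|D|) (connect0 (@force_step G) B)).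
move=> D BD maxD; rewrite /zero_forcing_set -(stalledT D) //.
  exact: force_step_sub.
move=> u v uD; apply/eqP=> defv.
have vD : v \notin D by have := set11 v; rewrite -defv inE; case/andP.
suff /maxD : connect (@force_step G) B (v |: D) by rewrite /= cardsU1 vD ltnn.
apply: connect_trans BD (connect1 _); apply/existsP; exists u.
by rewrite uD; apply/existsP; exists v; rewrite defv !eqxx.
Qed.

Lemma zero_forcing_of_cover (G : sgraph) (C : {set G}) :
  claw_free G -> 1 <= min_degree G -> vertex_cover C ->
  exists2 B : {set G}, zero_forcing_set B & #|B| = #|C|.
Proof.
move=> clawG degG coverC.
have indep u v : u \notin C -> v \notin C -> adj u v = false.
  move=> uC vC; have /forallP/(_ u)/forallP/(_ v) := coverC.
  by rewrite (negbTE uC) (negbTE vC) implybF => /negbTE.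
have nbr (u : G) : exists v, adj u v.
  have := leq_trans degG (min_degree_le u); rewrite /degree card_gt0.
  by case/set0Pn=> v; rewrite inE; exists v.
pose f u := xchoose (nbr u).
have adj_f u : adj u (f u) := xchooseP (nbr u).
(* The classes of [connect r] outside [C] are the components of the multigraph; [R] takes the
   canonical root of each, and [f] gives the neighbor it is exchanged for. *)
pose r : rel G := fun u v =>
  [&& u \notin C, v \notin C & [exists c, adj u c && adj v c]].
have r_sym : connect_sym r.
  apply: sym_connect_sym => u v; rewrite /r andbCA; congr [&& _, _ & _].
  by apply: eq_existsb => c; rewrite andbC.
pose R := [set u in ~: C | root r u == u].
have R_eq u v c : u \in R -> v \in R -> adj u c -> adj v c -> u = v.
  move=> + + uc vc; rewrite !inE => /andP[uC /eqP <-] /andP[vC /eqP <-].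
  apply/(rootP r_sym)/connect1; rewrite /r uC vC.
  by apply/existsP; exists c; rewrite uc.
have fRC : f @: R \subset C.
  apply/subsetP=> _ /imsetP[u uR ->]; apply: contraT => fuC.
  have [uC _] : u \notin C /\ True by move: uR; rewrite !inE => /andP[].
  by have := adj_f u; rewrite indep.
exists ((C :\: f @: R) :|: R); last first.
  have f_inj : {in R &, injective f}.
    by move=> u v uR vR fuv; apply: R_eq uR vR (adj_f u) _; rewrite fuv.
  rewrite cardsU (_ : _ :&: R = set0) ?cards0 ?subn0; last first.
    by apply/setP=> u; rewrite !inE; case: (u \in C); rewrite ?andbF.
  by rewrite cardsD (setIidPr fRC) -(card_in_imset f_inj) subnK ?subset_leq_card.
apply: zero_forcing_stalled => D; rewrite subUset => /andP[CD RD] stalled.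
(* A white [c] in [C] was exchanged for some [u] in [R]. Any white neighbor [w] of [u] is in [C] by
   independence, so it was exchanged for some [v] in [R]; sharing [w] forces [u = v], hence [w = c],
   and [u] could force [c]. *)
have CsubD c : c \in C -> c \in D.
  move=> cC; apply: contraT => cD.
  have /imsetP[u uR defc] : c \in f @: R.
    by apply: contraNT cD => cR; apply: (subsetP CD); rewrite inE cR.
  have /negP[] := stalled u c (subsetP RD u uR).
  rewrite eqEsubset sub1set !inE cD {2}defc adj_f !andbT.
  apply/subsetP=> w; rewrite !inE => /andP[wD uw].
  have uC : u \notin C by move: uR; rewrite !inE => /andP[].
  have wC : w \in C by apply: contraLR uw => wC; rewrite indep.
  have /imsetP[v vR defw] : w \in f @: R.
    by apply: contraNT wD => wR; apply: (subsetP CD); rewrite inE wR.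
  by rewrite defw defc (R_eq u v w) // defw.
(* The common neighbor [c] lies in [C], hence is blue. If [v] were white, a second white neighbor
   [w] of [c] would be outside [C], and [u], [v], [w] would be independent leaves of a claw at [c];
   so [c] could force [v]. *)
have r_D u v : r u v -> u \in D -> v \in D.
  case/and3P=> uC vC /existsP[c /andP[uc vc]] uD; apply: contraT => vD.
  have cC : c \in C by apply: contraLR uc => cC; rewrite indep.
  have /negP[] := stalled c v (CsubD c cC).
  rewrite eqEsubset sub1set !inE vD adj_sym vc !andbT.
  apply/subsetP=> w; rewrite !inE => /andP[wD cw].
  have wC : w \notin C by apply: contra wD; apply: CsubD.
  apply: contraT => wv; have := @claw_free_adj _ c u v w clawG.
  rewrite ![adj c _]adj_sym uc vc [adj w c]adj_sym cw !indep //= => -> //.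
  rewrite !inE negb_or [v == w]eq_sym wv !andbT.
  by apply/andP; split; [apply: contraNneq vD | apply: contraNneq wD] => <-.
apply/setP=> u; rewrite inE; have [/CsubD //|uC] := boolP (u \in C).
(* Since [r] never leaves the complement of [C], the root of [u] is in [R], hence blue, and blue
   travels along an [r]-path from it to [u]. *)
have closedC : closed r (mem C).
  by move=> v w /and3P[/negbTE vC /negbTE wC _]; rewrite vC wC.
have rootR : root r u \in R.
  rewrite !inE (root_root r_sym) eqxx andbT.
  by rewrite -(closed_connect closedC (connect_root r u)).
have /connectP[q] : connect r (root r u) u by rewrite r_sym connect_root.
elim: q (root r u) (subsetP RD _ rootR) => [|w q IHq] v vD /=.
  by move=> _ ->.
by case/andP=> /r_D/(_ vD); apply: IHq.
Qed.

Lemma zero_forcing_number_le_cover_number (G : sgraph) :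
  claw_free G -> 1 <= min_degree G -> zero_forcing_number G <= cover_number G.
Proof.
move=> clawG degG; rewrite /cover_number; case: arg_minnP => [|C coverC _].
  by apply/forallP=> u; apply/forallP=> v; rewrite !inE implybT.
have [B zfB <-] := zero_forcing_of_cover clawG degG coverC.
exact: zero_forcing_number_le.
Qed.

(** With no blue vertex, no force can ever start. *)
Lemma zero_forcing_number_gt0 (G : sgraph) :
  0 < #|G| -> 0 < zero_forcing_number G.
Proof.
move=> G_gt0; rewrite /zero_forcing_number; case: arg_minnP => [|B zfB _].
  exact: connect0.
rewrite card_gt0; apply: contraTneq zfB => ->; apply/connectP=> -[[|D p] /=].
  by move=> _ eqT; move: G_gt0; rewrite -cardsT eqT cards0.
by case/andP=> /existsP[u]; rewrite inE.
Qed.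

Lemma claw_free_card_lt4 (G : sgraph) : #|G| < 4 -> claw_free G.
Proof.
move=> G_lt4 [S [f f_bij _]]; have := bij_eq_card f_bij.
rewrite card_sig card_sum !card_ord => S4.
by have := leq_trans (max_card (mem S)) (ltnSE G_lt4); rewrite S4.
Qed.

Theorem theorem1 :
  (forall G : sgraph,
     connected_graph G -> claw_free G -> 1 <= min_degree G ->
     zero_forcing_number G <= cover_number G) /\
  (exists G : sgraph,
     [/\ connected_graph G, claw_free G, 1 <= min_degree G
       & zero_forcing_number G = cover_number G]).
Proof.
split=> [G _|]; first exact: zero_forcing_number_le_cover_number.
pose K2 := complete_bipartite 1 1; exists K2.
have cardK2 : #|K2| = 2 by rewrite card_sum !card_ord.
have clawK2 : claw_free K2 by apply: claw_free_card_lt4; rewrite cardK2.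
have degK2 : 1 <= min_degree K2.
  (* The default value of the minimum, here 2, must be positive as well. *)
  apply: (big_ind (fun n => 0 < n)) => [|m n m0 n0|u _]; first by rewrite cardK2.
    by rewrite leq_min m0.
  by rewrite card_gt0; apply/set0Pn; case: u => i;
    [exists (inr ord0) | exists (inl ord0)]; rewrite inE.
split=> //.
  split=> [|x y]; first by rewrite cardK2.
  have [-> | neq_xy] := eqVneq x y; first exact: connect0.
  by apply: connect1; case: x y neq_xy => i [] j; rewrite !ord1 ?eqxx.
(* Both invariants equal 1: a single endpoint covers the only edge, and a zero forcing set is
   nonempty. *)
apply/eqP; rewrite eqn_leq zero_forcing_number_le_cover_number //=.
apply: leq_trans (zero_forcing_number_gt0 _); last by rewrite cardK2.
rewrite -(cards1 (inl ord0 : K2)); apply: cover_number_le.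
by apply/forallP=> -[i|i]; apply/forallP=> -[j|j]; rewrite !ord1 !inE ?eqxx.
Qed.
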